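(* (Reverse Hölder inequality) Let $w\in A_p(\mu)$ for some $p\in[1,\infty)$. Then there are constants $C,\varepsilon>0$ such that for every $R\in\mathcal R$ $$\Big(\frac1{\mu(R)}\sum_{y\in R}w(y)^{1+\varepsilon}\mu(y)\Big)^{1/(1+\varepsilon)}\le\frac{C}{\mu(R)}\sum_{y\in R}w(y)\mu(y).$$
   Context: Tree and flow measure. $T$ is (the vertex set of) an infinite tree, i.e. an infinite connected graph with no loops. $d$ is the geodesic distance and $x\sim y$ means $d(x,y)=1$. $\partial T$ is the boundary of $T$ (equivalence classes of semi-infinite geodesics, two being equivalent if they eventually coincide). Fix $\omega_*\in\partial T$; $[x,\omega_* )$ is the semi-infinite geodesic from $x$ to $\omega_*$, and $x\le y$ means $y\in[x,\omega_* )$. Fix $o\in T$, enumerate $[o,\omega_* )=\{x_j\}_{j\in\mathbb N}$ with $x_0=o$ and $d(x_j,x_k)=|j-k|$, and define the level $\ell(x)=\lim_{j\to\infty}(j-d(x,x_j))$. The set of successors of $x$ is $s(x)=\{y\sim x:\ell(y)=\ell(x)-1\}$. A flow measure is a positive function $\mu$ on $T$ with $\mu(x)=\sum_{y\in s(x)}\mu(y)$ for all $x\in T$; $\mu(E)=\sum_{y\in E}\mu(y)$. Standing assumption: $\mu$ is a flow measure which is locally doubling on $(T,d)$, i.e. for every $r>0$ there is $D_r$ with $\mu(B(x,2r))\le D_r\,\mu(B(x,r))$ for all $x\in T$ (this implies that $T$ has uniformly bounded degree). A weight is a positive function on $T$. Trapezoids. Fix a number $\beta\ge 12$. For $x\in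 T$ and $h_1,h_2\in\mathbb N$, $h_1<h_2$, the trapezoid with root $x$ and heights $h_1,h_2$ is $R_{h_1}^{h_2}(x)=\{y\in T: y\le x,\ h_1\le d(x,y)<h_2\}$. It is admissible if $2\le h_2/h_1\le\beta$ (so $h_1\ge1$). $\mathcal R$ is the family of all admissible trapezoids and all singletons. Weights. For a weight $w$ and $E\subset T$, $w_\mu(E)=\sum_{y\in E}w(y)\mu(y)$. For $p\in(1,\infty)$, $w\in A_p(\mu)$ means $$[w]_{A_p(\mu)}=\sup_{R\in\mathcal R}\Big(\frac1{\mu(R)}\sum_{y\in R}w(y)\mu(y)\Big)\Big(\frac1{\mu(R)}\sum_{y\in R}w(y)^{-1/(p-1)}\mu(y)\Big)^{p-1}<\infty,$$ and $w\in A_1(\mu)$ means $[w]_{A_1(\mu)}=\sup_{R\in\mathcal R}\frac{w_\mu(R)}{\mu(R)}\|w^{-1}\|_{L^\infty(R)}<\infty$. *)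

(* Defs.v *)
From HB Require Import structures.
From mathcomp Require Import all_boot all_order all_algebra.
From mathcomp Require Import all_classical all_reals all_analysis.

Set Implicit Arguments.
Unset Strict Implicit.
Unset Printing Implicit Defensive.

Import Order.TTheory GRing.Theory Num.Theory.
Import numFieldNormedType.Exports.

Local Open Scope classical_set_scope.
Local Open Scope ring_scope.

Section Tree.
Variables (T : choiceType) (e : rel T).

Definition connects (x y : T) (n : nat) : Prop :=
  exists p : seq T, [/\ path e x p, last x p = y & size p = n].

(* No loops: [ucycle e c] says that [c] is a closed walk through pairwise
   distinct vertices; for [size c <= 2] this is a vertex or a back-and-forth
   edge, not a cycle of the graph. *)
Record infinite_tree : Prop := InfiniteTree {
  tree_infinite : infinite_set [set: T];
  tree_sym : symmetric e;
  tree_irrefl : irreflexive e;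
  tree_connected : forall x y, exists n, connects x y n;
  tree_acyclic : forall c : seq T, ucycle e c -> (size c <= 2)%N }.

Definition gdist (x y : T) : nat :=
  xget 0%N [set n | connects x y n /\ forall m, connects x y m -> (n <= m)%N].

Definition geodesic_ray (g : nat -> T) : Prop :=
  forall i j : nat, (i <= j)%N -> gdist (g i) (g j) = (j - i)%N.

(* Rays are parametrised from their starting points, so rays that eventually
   coincide as paths agree only up to a shift of the parameter. *)
Definition eventually_coincide (g h : nat -> T) : Prop :=
  exists m n : nat, forall k : nat, g (m + k)%N = h (n + k)%N.

(* A boundary point is a whole equivalence class of rays. *)
Definition boundary : set (set (nat -> T)) :=
  [set omega | exists2 g, geodesic_ray g &
    omega = [set h | geodesic_ray h /\ eventually_coincide g h]].

Variable omega : set (nat -> T).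

(* The enumeration x = x_0, x_1, ... of [x, omega); in a tree there is exactly
   one ray of the class [omega] issuing from [x], and the default value
   of [xget] plays no role. *)
Definition ray_to (x : T) : nat -> T :=
  xget (fun=> x) [set g | omega g /\ g 0%N = x].

Definition tle (x y : T) : Prop := exists n : nat, ray_to x n = y.

Definition trapezoid (x : T) (h1 h2 : nat) : set T :=
  [set y | tle y x /\ (h1 <= gdist x y < h2)%N].

End Tree.

Section Flow.
Variables (R : realType) (T : choiceType) (e : rel T).
Variables (omega : set (nat -> T)) (o : T).

Definition level (x : T) : R :=
  limn (fun j : nat => j%:R - (gdist e x (ray_to omega o j))%:R : R).

Definition successors (x : T) : set T :=
  [set y | e x y /\ level y = level x - 1].

Definition weight (w : T -> R) : Prop := forall x, 0 < w x.

Variable mu : T -> R.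

(* The sum of [f y * mu y] over [y] in [E], in [0, +oo] for nonnegative [f]. *)
Definition wsum (f : T -> R) (E : set T) : \bar R :=
  (\esum_(y in E) (f y * mu y)%:E)%E.

Definition mass (E : set T) : \bar R := (\esum_(y in E) (mu y)%:E)%E.

Definition flow_measure : Prop :=
  (forall x, 0 < mu x) /\ (forall x, (mu x)%:E = mass (successors x)).

Definition gball (x : T) (r : R) : set T := [set y | (gdist e x y)%:R <= r].

Definition locally_doubling : Prop :=
  forall r : R, 0 < r -> exists D : R, forall x : T,
    (mass (gball x (2 * r)) <= D%:E * mass (gball x r))%E.

Variable beta : R.

Definition admissible (h1 h2 : nat) : Prop :=
  [/\ (0 < h1)%N, (h1 < h2)%N, 2 <= h2%:R / h1%:R :> R
    & h2%:R / h1%:R <= beta].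

Definition trapezoids : set (set T) :=
  [set E | (exists x h1 h2, admissible h1 h2 /\ E = trapezoid e omega x h1 h2)
           \/ (exists x, E = [set x])].

(* Only used for [E] in [trapezoids]; such [E] are finite when [mu] is a
   locally doubling flow measure, and then both [fine]s act on finite values. *)
Definition avg (f : T -> R) (E : set T) : R :=
  fine (wsum f E) / fine (mass E).

Definition Ap_const (p : R) (w : T -> R) : \bar R :=
  ereal_sup [set (avg w E
      * avg (fun y => w y `^ (- (p - 1)^-1)) E `^ (p - 1))%:E
    | E in trapezoids].

(* As [mu] is positive at every point, the norm of L^oo(E) is a supremum. *)
Definition Linfty_norm (f : T -> R) (E : set T) : \bar R :=
  ereal_sup [set `|f y|%:E | y in E].

Definition A1_const (w : T -> R) : \bar R :=
  ereal_sup [set ((avg w E)%:E * Linfty_norm (fun y => (w y)^-1%R) E)%E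
    | E in trapezoids].

Definition Ap (p : R) (w : T -> R) : Prop :=
  if p == 1 then (A1_const w < +oo)%E else (Ap_const p w < +oo)%E.

End Flow.

(* Main.v *)
Require Import Defs.
From HB Require Import structures.
From mathcomp Require Import all_boot all_order all_algebra.
From mathcomp Require Import all_classical all_reals all_analysis.
From mathcomp Require Import zify ring lra.

(** The proof is the stopping-time argument of the Euclidean case, run on finite
lists of vertices.

An admissible trapezoid can be cut, again and again, into smaller admissible
trapezoids until only singletons are left, each piece keeping a fixed fraction
of the mass of the trapezoid that it is cut from ([dyadic_trap]). A tall trapezoid
is cut horizontally; a short one is cut vertically, along the successors of its
root, and there local doubling bounds the loss of mass; when the lower height
is 1, only boundedly many layers remain, and the trapezoid is cut into its points.

The weight condition enters only through [Ap_spreads_uniform]: removing from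
a trapezoid points of at most half of its mass leaves a fixed fraction [1 / K]
of its weight.

For [dyadic_reverse_Holder], let [t] bound the average of [w] over [Q], and stop
the subdivision of [Q] at the first pieces whose average exceeds [2 t]. Outside
these pieces [w <= 2 t]. The pieces have at most half of the mass of [Q], hence
at most [1 - 1 / K] of its weight, and their averages are at most [2 N t], since
their parents were not stopped. By induction the inequality holds on each piece
with [2 N t] in place of [t], which costs a factor [(2 N) ^ eps]; for small
[eps] this factor is absorbed by the gain [1 - 1 / K].

The rest turns trapezoids into lists: in a tree simple paths are unique, so each
vertex [x] has a parent on the geodesic from [x] to the boundary point, the
successors of [x] are the vertices with parent [x], and by the flow property each
layer below [x] carries the mass of [x]. *)

Import Order.TTheory GRing.Theory Num.Theory.
Import numFieldNormedType.Exports.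
Set Implicit Arguments.
Unset Strict Implicit.
Unset Printing Implicit Defensive.
Local Open Scope classical_set_scope.
Local Open Scope ring_scope.

(** * Weights that do not concentrate, and stopping times *)

(** A quantitative A_infinity condition on one list. The two parts are given as
lists so that no disjointness has to be tracked. *)
Definition spreads (R : realType) (T : choiceType) (mu w : T -> R) (K : R)
    (Q : seq T) : Prop :=
  forall bad good, perm_eq Q (bad ++ good) ->
    2 * \sum_(y <- bad) mu y <= \sum_(y <- Q) mu y ->
    \sum_(y <- Q) w y * mu y <= K * \sum_(y <- good) w y * mu y.

Section StoppingTime.
Variables (R : realType) (T : choiceType) (mu w : T -> R) (N K : R).
Hypotheses (mu_gt0 : forall y, 0 < mu y) (w_gt0 : forall y, 0 < w y).
Hypotheses (N_ge1 : 1 <= N) (K_ge1 : 1 <= K).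

Local Notation M s := (\sum_(y <- s) mu y).
Local Notation W s := (\sum_(y <- s) w y * mu y).

(** The subdivision tree of [Q] is kept only as a derivation, since it is used
only for induction. [N] plays the part of the dyadic doubling constant: passing
to a child multiplies averages of nonnegative functions by at most [N]. *)
Inductive dyadic : seq T -> Prop :=
| dyadic_point x : dyadic [:: x]
| dyadic_split Q qs of
    spreads mu w K Q
  & perm_eq Q (flatten qs)
  & (forall q, q \in qs -> M Q <= N * M q)
  & (forall q, q \in qs -> dyadic q) : dyadic Q.

Variables (C eps : R).
Hypotheses (eps_gt0 : 0 < eps).
Hypothesis epsE : (2 * N) `^ eps = 1 + (2 * K)^-1.
Hypothesis CE : C = 2 * K * 2 `^ eps.

Local Notation Phi s := (\sum_(y <- s) w y `^ (1 + eps) * mu y).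

(** A Calderon-Zygmund decomposition of [Q] at height [l]: [bad] collects the
stopped pieces. The third conjunct already contains the reverse Holder
inequality on these pieces, whose averages lie between [l] and [N l]. *)
Definition stopped (l : R) (Q : seq T) : Prop :=
  exists bad good, [/\ perm_eq Q (bad ++ good), l * M bad <= W bad,
    Phi bad <= C * (N * l) `^ eps * W bad &
    forall y, y \in good -> w y <= l].

Lemma stopped_flatten l qs :
  (forall q, q \in qs -> stopped l q) -> stopped l (flatten qs).
Proof.
elim: qs => [_|q qs IH qqs].
  by exists [::], [::]; rewrite !big_nil !mulr0.
have [b1 [g1 [p1 m1 f1 y1]]] := qqs q (mem_head _ _).
have [|b2 [g2 [p2 m2 f2 y2]]] := IH.
  by move=> r rqs; apply: qqs; rewrite inE rqs orbT.
exists (b1 ++ b2), (g1 ++ g2); split.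
- by rewrite (perm_trans (perm_cat p1 p2)) // perm_catACA.
- by rewrite !big_cat /= mulrDr lerD.
- by rewrite !big_cat /= mulrDr lerD.
- by move=> y; rewrite mem_cat => /orP[/y1|/y2].
Qed.

Lemma le_wsum_part Q qs q : perm_eq Q (flatten qs) -> q \in qs -> W q <= W Q.
Proof.
move=> pQ qqs; rewrite (perm_big _ pQ) big_flatten /=.
rewrite (perm_big _ (perm_to_rem qqs)) big_cons lerDl.
by apply: sumr_ge0 => r _; apply: sumr_ge0 => y _; rewrite mulr_ge0 // ltW.
Qed.

Lemma C_ge1 : 1 <= C.
Proof.
have e2 : 1 <= 2 `^ eps :> R by rewrite -[leLHS](powRr0 2) ler_powR ?ler1n // ltW.
by rewrite CE -mulrA; have := mulr_ege1 K_ge1 e2; lra.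
Qed.

Lemma W_ge0 s : 0 <= W s.
Proof. by apply: sumr_ge0 => y _; rewrite mulr_ge0 // ltW. Qed.

Lemma Phi_le l s : (forall y, y \in s -> w y <= l) -> Phi s <= l `^ eps * W s.
Proof.
move=> sl; rewrite mulr_sumr big_seq [leRHS]big_seq; apply: ler_sum => y ys.
have wy0 := ltW (w_gt0 y).
rewrite powRD; last by rewrite [w y == 0]gt_eqF ?implybT.
rewrite powRr1 // mulrA ler_wpM2r //; first exact: ltW.
rewrite mulrC ler_wpM2r //; apply: ge0_ler_powR; rewrite ?nnegrE ?sl //.
  exact: ltW.
exact: le_trans (sl _ ys).
Qed.

(** The stopped part carries at most [1 - h] of the weight with [h = 1 / K]; as
[(1 + h / 2) * (1 - h) + h / 2 <= 1], the factor [(2 N) ^ eps = 1 + h / 2]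
lost on it is paid for, and the constant [C] is such that the bounded
part costs the remaining [h / 2]. *)
Lemma self_improve Q : spreads mu w K Q ->
  (forall l, 0 < l -> W Q <= l * M Q -> stopped l Q) ->
  forall t, 0 < t -> W Q <= t * M Q -> Phi Q <= C * t `^ eps * W Q.
Proof.
move=> AQ SQ t t0 WQ.
have M0 s : 0 <= M s by apply: sumr_ge0 => y _; exact: ltW.
have t20 : 0 < 2 * t by rewrite mulr_gt0.
have [|bad [good [pQ mb fb yg]]] := SQ (2 * t) t20.
  by rewrite (le_trans WQ) // ler_wpM2r // ler_peMl ?ler1n // ltW.
have WE : W Q = W bad + W good by rewrite (perm_big _ pQ) big_cat.
have PE : Phi Q = Phi bad + Phi good by rewrite (perm_big _ pQ) big_cat.
have mbad : 2 * M bad <= M Q.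
  rewrite -(ler_pM2l t0) (le_trans _ WQ) // mulrA [t * 2]mulrC.
  by rewrite (le_trans mb) // WE lerDl W_ge0.
have {AQ} Kg := AQ _ _ pQ mbad.
have {yg} fg := Phi_le yg.
rewrite PE; apply: (le_trans (lerD fb fg)).
have -> : N * (2 * t) = (2 * N) * t by ring.
have N0 : 0 <= 2 * N by rewrite mulr_ge0 // (le_trans ler01).
rewrite (powRM _ N0 (ltW t0)) (powRM _ (ler0n R 2) (ltW t0)) epsE.
have Wb : W bad <= (1 - K^-1) * W Q.
  have : K^-1 * W Q <= W good.
    by rewrite -ler_pdivlMl ?invr_gt0 ?(lt_le_trans ltr01) // invrK.
  by rewrite mulrBl mul1r {2}WE; lra.
have Wg : W good <= W Q by rewrite WE lerDr W_ge0.
have te : 0 <= t `^ eps by exact: powR_ge0.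
have K0 : 0 < K by rewrite (lt_le_trans ltr01).
have C0 : 0 < C by rewrite (lt_le_trans ltr01 C_ge1).
have -> : 2 `^ eps = C * (2 * K)^-1.
  by rewrite CE mulrAC mulfV ?mul1r // gt_eqF // mulr_gt0.
rewrite -[_ / _ * _]mulrA [(2 * K)^-1 * _]mulrC.
have h0 : 0 <= K^-1 by rewrite invr_ge0 ltW.
have h1 : K^-1 <= 1 by rewrite invf_le1.
have -> : (2 * K)^-1 = K^-1 / 2 by rewrite invfM mulrC.
set h := K^-1 in h0 h1 Wb *; set te' := t `^ eps in te *.
apply: (@le_trans _ _ (C * te' * ((1 + h / 2) * ((1 - h) * W Q) + h / 2 * W Q))).
  have -> : C * ((1 + h / 2) * te') * W bad + C * (te' * (h / 2)) * W good =
    C * te' * ((1 + h / 2) * W bad + h / 2 * W good) by ring.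
  rewrite ler_wpM2l ?mulr_ge0 // ?(ltW C0) // lerD // ler_wpM2l //; lra.
rewrite ler_wpM2l ?mulr_ge0 // ?(ltW C0) //.
have -> : (1 + h / 2) * ((1 - h) * W Q) + h / 2 * W Q = (1 - h ^+ 2 / 2) * W Q.
  by field.
by rewrite ler_piMl ?W_ge0 // gerBl divr_ge0 // sqr_ge0.
Qed.

(** Both claims need each other: the decomposition of [Q] stops at a child by the
inequality on that child, and the inequality on [Q] follows from the
decomposition of [Q] at height [2 t]. *)
Lemma dyadic_stopping Q : dyadic Q ->
  (forall t, 0 < t -> W Q <= t * M Q -> Phi Q <= C * t `^ eps * W Q) /\
  (forall l, 0 < l -> W Q <= l * M Q -> stopped l Q).
Proof.
elim=> {Q} [x|Q qs AQ pQ NQ _ IH].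
  have wx t : W [:: x] <= t * M [:: x] -> w x <= t.
    by rewrite !big_seq1 ler_pM2r.
  split=> t t0 /wx wt.
    have pt : 0 <= t `^ eps by exact: powR_ge0.
    have P1 : Phi [:: x] <= t `^ eps * W [:: x].
      by apply: Phi_le => y; rewrite inE => /eqP->.
    apply: (le_trans P1); rewrite ler_wpM2r ?W_ge0 //.
    by rewrite ler_peMl ?C_ge1.
  exists [::], [:: x]; rewrite !big_nil !mulr0; split=> // y.
  by rewrite inE => /eqP->.
suff SQ l : 0 < l -> W Q <= l * M Q -> stopped l Q.
  by split=> //; exact: self_improve.
move=> l0 WQ.
have [|bad [good [pf mb fb yg]]] := @stopped_flatten l qs; last first.
  by exists bad, good; split=> //; rewrite (perm_trans pQ).
move=> q qqs; have [Gq Sq] := IH q qqs.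
have [Wq|/ltW Wq] := leP (W q) (l * M q); first exact: Sq.
(* The child [q] is stopped as a whole; its average is at most [N * l] because
   the average of [Q] is at most [l]. *)
exists q, [::]; rewrite cats0; split=> //; apply: Gq.
  by rewrite mulr_gt0 // (lt_le_trans ltr01).
rewrite (le_trans (le_wsum_part pQ qqs)) // (le_trans WQ) //.
by rewrite [N * l]mulrC -mulrA ler_pM2l // NQ.
Qed.

End StoppingTime.

(** Here [t] stands for any upper bound of the average of [w] over [Q]; this avoids
divisions by the mass, and makes the bound monotone in [t]. *)
Lemma dyadic_reverse_Holder (R : realType) (T : choiceType) (mu w : T -> R)
    (N K : R) :
  (forall y, 0 < mu y) -> (forall y, 0 < w y) -> 1 <= N -> 1 <= K ->
  exists C eps : R, [/\ 0 < C, 0 < eps &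
    forall Q t, dyadic mu w N K Q -> 0 < t ->
      \sum_(y <- Q) w y * mu y <= t * \sum_(y <- Q) mu y ->
      \sum_(y <- Q) w y `^ (1 + eps) * mu y <=
        C * t `^ eps * \sum_(y <- Q) w y * mu y].
Proof.
move=> mu0 w0 N1 K1.
have K0 : 0 < K by rewrite (lt_le_trans ltr01).
have a1 : 1 < 1 + (2 * K)^-1 by rewrite ltrDl invr_gt0 mulr_gt0.
have b1 : 1 < 2 * N by nra.
pose eps := ln (1 + (2 * K)^-1) / ln (2 * N).
have eps0 : 0 < eps by rewrite divr_gt0 // ln_gt0.
have epsE : (2 * N) `^ eps = 1 + (2 * K)^-1.
  have N20 : 2 * N != 0 by rewrite gt_eqF // (lt_trans ltr01).
  rewrite /powR (negbTE N20) /eps divfK ?lnK ?posrE ?(lt_trans ltr01) //.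
  by rewrite gt_eqF // ln_gt0.
exists (2 * K * 2 `^ eps), eps; split=> //.
  by rewrite !mulr_gt0 // powR_gt0.
move=> Q t dQ; have [+ _] := dyadic_stopping mu0 w0 N1 K1 eps0 epsE erefl dQ.
exact.
Qed.

(** * Muckenhoupt weights on lists *)

Section FiniteAverages.
Variables (R : realType) (T : choiceType) (mu : T -> R).
Hypothesis mu_gt0 : forall y, 0 < mu y.

Lemma esum_uniq_seq (f : T -> R) s : uniq s -> (forall y, 0 <= f y) ->
  (\esum_(y in [set` s]) (f y)%:E)%E = (\sum_(y <- s) f y)%:E.
Proof.
move=> us f0; rewrite esum_fset; last by move=> y _; rewrite lee_fin.
- by rewrite fsumEFin ?(fsbig_seq _ _ us) //; exact: finite_seq.
- exact: finite_seq.
Qed.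

Lemma avg_uniq_seq (f : T -> R) s : uniq s -> (forall y, 0 <= f y) ->
  avg mu f [set` s] = (\sum_(y <- s) f y * mu y) / (\sum_(y <- s) mu y).
Proof.
move=> us f0; have mu0 y : 0 <= mu y by exact: ltW.
have fmu0 y : 0 <= f y * mu y by rewrite mulr_ge0.
by rewrite /avg /wsum /mass (esum_uniq_seq us fmu0) (esum_uniq_seq us mu0).
Qed.

Lemma mass_gt0 s : s != [::] -> 0 < \sum_(y <- s) mu y.
Proof.
case: s => // y s _; rewrite big_cons ltr_pwDl //.
by apply: sumr_ge0 => z _; exact: ltW.
Qed.

Variable w : T -> R.
Hypothesis w_gt0 : forall y, 0 < w y.

Local Notation M s := (\sum_(y <- s) mu y).
Local Notation W s := (\sum_(y <- s) w y * mu y).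

(** An A_1 weight is bounded below on [Q] by [1 / A] times its average. *)
Lemma A1_spreads Q A : M Q != 0 ->
  (forall y, y \in Q -> W Q / M Q * (w y)^-1 <= A) ->
  spreads mu w (2 * A) Q.
Proof.
move=> MQ0 HA bad good pQ Mbad.
have ME : M Q = M bad + M good by rewrite (perm_big _ pQ) big_cat.
have MQ : 0 < M Q by rewrite lt0r MQ0 sumr_ge0 // => y _; exact: ltW.
have : W Q / M Q * M good <= A * W good.
  rewrite !mulr_sumr big_seq [leRHS]big_seq; apply: ler_sum => y yg.
  rewrite mulrA ler_wpM2r ?(ltW (mu_gt0 y)) // -ler_pdivrMr // HA //.
  by rewrite (perm_mem pQ) mem_cat yg orbT.
have : W Q / M Q * M Q <= W Q / M Q * (2 * M good).
  rewrite ler_wpM2l //; last lra.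
  by rewrite divr_ge0 ?(ltW MQ) // sumr_ge0 // => y _; rewrite mulr_ge0 // ltW.
rewrite divfK //; lra.
Qed.

(** Let [sg = w ^ (- 1 / u)], of average [s] over [Q]. Where [sg <= 4 s], one has
[(4 s) ^ u * w >= 1]; elsewhere [1 - sg / (4 s)] is negative. Hence
[(4 s) ^ u * w >= 1 - sg / (4 s)] everywhere, and summing over a part with at
least half of the mass leaves at least [1 / 2 - 1 / 4] of the mass. *)
Lemma Ap_spreads Q A u : 0 < u -> M Q != 0 ->
  W Q / M Q * ((\sum_(y <- Q) w y `^ (- u^-1) * mu y) / M Q) `^ u <= A ->
  spreads mu w (4 * A * 4 `^ u) Q.
Proof.
move=> u0 MQ0 HA bad good pQ Mbad.
pose sg y := w y `^ (- u^-1).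
pose s := (\sum_(y <- Q) sg y * mu y) / M Q.
have sg0 y : 0 < sg y by exact: powR_gt0.
have MQ : 0 < M Q by rewrite lt0r MQ0 sumr_ge0 // => y _; exact: ltW.
have ME : M Q = M bad + M good by rewrite (perm_big _ pQ) big_cat.
have s0 : 0 < s.
  rewrite divr_gt0 //; case: (Q) MQ0 => [|y r _]; first by rewrite big_nil eqxx.
  rewrite big_cons ltr_pwDl ?mulr_gt0 //.
  by apply: sumr_ge0 => z _; rewrite mulr_ge0 // ltW.
have s40 : 0 < 4 * s by rewrite mulr_gt0.
have point y : 1 - sg y / (4 * s) <= (4 * s) `^ u * w y.
  have [sy|sy] := leP (sg y) (4 * s).
    have -> : w y = (sg y `^ u)^-1.
      rewrite -powRrM mulNr mulVf ?gt_eqF // powR_inv1 ?invrK // ltW //.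
    rewrite (@le_trans _ _ 1) // ?gerBl ?divr_ge0 ?(ltW s40) ?(ltW (sg0 y)) //.
    rewrite ler_pdivlMr ?powR_gt0 // mul1r.
    by apply: ge0_ler_powR; rewrite ?nnegrE ?(ltW u0) ?(ltW s40) ?(ltW (sg0 y)).
  rewrite (@le_trans _ _ 0) //; last by rewrite mulr_ge0 ?powR_ge0 // ltW.
  by rewrite subr_le0 ler_pdivlMr // mul1r ltW.
have Sgood : \sum_(y <- good) sg y * mu y <= s * M Q.
  rewrite divfK // (perm_big _ pQ) big_cat /= lerDr.
  by apply: sumr_ge0 => z _; rewrite mulr_ge0 // ltW.
have low : M good - (\sum_(y <- good) sg y * mu y) / (4 * s)
    <= (4 * s) `^ u * W good.
  rewrite mulr_sumr mulr_suml -sumrB; apply: ler_sum => y _.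
  rewrite (_ : mu y - _ = (1 - sg y / (4 * s)) * mu y).
    by rewrite mulrA ler_pM2r.
  by rewrite mulrBl mul1r mulrAC.
have Sg4 : (\sum_(y <- good) sg y * mu y) / (4 * s) <= M Q / 4.
  rewrite ler_pdivrMr // (le_trans Sgood) //.
  by rewrite (_ : M Q / 4 * (4 * s) = s * M Q) //; field.
have MQ4 : M Q <= 4 * ((4 * s) `^ u * W good) by lra.
have {HA} HA : W Q * s `^ u <= A * M Q.
  move: HA; rewrite -/s => HA; rewrite -ler_pdivrMr //.
  by rewrite mulrAC.
have A0 : 0 <= A.
  rewrite -(pmulr_lge0 _ MQ) (le_trans _ HA) // mulr_ge0 ?powR_ge0 //.
  by apply: sumr_ge0 => z _; rewrite mulr_ge0 // ltW.
rewrite -(ler_pM2r (powR_gt0 u s0)) (le_trans HA) //.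
rewrite (le_trans (ler_wpM2l A0 MQ4)) //.
rewrite powRM // ?(ltW s0) // le_eqVlt; apply/orP; left; apply/eqP; ring.
Qed.

Variables (e : rel T) (omega : set (nat -> T)) (beta p : R).

Lemma Ap_spreads_uniform : 1 <= p -> Ap e omega mu beta p w ->
  exists2 K : R, 1 <= K & forall Q, uniq Q -> Q != [::] ->
    trapezoids e omega beta [set` Q] -> spreads mu w K Q.
Proof.
move=> p1 ApH.
suff [K HK] : exists K : R, forall Q, uniq Q -> Q != [::] ->
    trapezoids e omega beta [set` Q] -> spreads mu w K Q.
  exists (Num.max 1 K); first by rewrite le_max lexx.
  move=> Q uQ Q0 tQ bad good pQ mb; rewrite (le_trans (HK Q uQ Q0 tQ _ _ pQ mb)) //.
  rewrite ler_wpM2r ?le_max ?lexx ?orbT //.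
  by apply: sumr_ge0 => y _; rewrite mulr_ge0 // ltW.
have fin_sup (S : set (\bar R)) : (ereal_sup S < +oo)%E ->
    exists A : R, forall x, S x -> (x <= A%:E)%E.
  move=> Soo; exists (fine (ereal_sup S)) => x Sx.
  have xS := ereal_sup_ubound Sx.
  case: (ereal_sup S) Soo xS => [r| |] //= _.
  by rewrite leeNy_eq => /eqP ->; rewrite leNye.
have w0 y : 0 <= w y by exact: ltW.
move: ApH; rewrite /Ap; case: eqP => [_|/eqP pn1] /fin_sup[A HA].
  exists (2 * A) => Q uQ Q0 tQ; have MQ := mass_gt0 Q0.
  apply: A1_spreads; first by rewrite gt_eqF.
  move=> y yQ; rewrite -lee_fin; apply: le_trans (HA _ _); last by exists [set` Q].
  rewrite EFinM -avg_uniq_seq //; apply: lee_wpmul2l.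
    rewrite lee_fin avg_uniq_seq // divr_ge0 ?(ltW MQ) //.
    by apply: sumr_ge0 => z _; rewrite mulr_ge0 // ltW.
  by apply: ereal_sup_ubound; exists y => //; rewrite ger0_norm // invr_ge0.
exists (4 * A * 4 `^ (p - 1)) => Q uQ Q0 tQ; have MQ := mass_gt0 Q0.
apply: Ap_spreads; [by rewrite subr_gt0 lt_neqAle eq_sym pn1|by rewrite gt_eqF|].
rewrite -!avg_uniq_seq //; last by move=> y; exact: powR_ge0.
by rewrite -lee_fin; apply: HA; exists [set` Q].
Qed.

End FiniteAverages.

(** * Simple paths and geodesic rays in a tree *)

Section TreeGeometry.
Variables (T : choiceType) (e : rel T).
Hypothesis tree : infinite_tree e.
Let e_sym := tree_sym tree.

(** Follow [p] up to its first vertex [v] on [q], and return to [x] along [q]: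
this is a cycle, so it has at most two vertices, which forces [v] to be the head
of both paths. *)
Lemma simple_paths_same_head x p q :
  path e x p -> uniq (x :: p) -> path e x q -> uniq (x :: q) ->
  last x p = last x q -> p != [::] -> head x p = head x q.
Proof.
move=> pp up pq uq lpq p0.
have lp : last x p \in p.
  by case: p p0 {pp up lpq} => //= a p _; exact: mem_last.
have lq : last x p \in q.
  rewrite lpq; case: q pq uq lpq => [|b q] //= _ _ lpq; last exact: mem_last.
  by move: up; rewrite cons_uniq -{1}lpq lp.
have hasv : has (mem q) p by apply/hasP; exists (last x p).
case: (split_find hasv) pp up => v p1 p2 /= vq p1q.
rewrite cat_path mem_cat negb_or cat_uniq.
move=> /andP[pp1 _] /andP[/andP[xp1 _]] /andP[up1 _].
move: pq uq p1q; case: (splitPr vq) => q1 q2.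
rewrite -cat_rcons cat_path => /andP[pq1 _] uq p1q.
have cyc : ucycle e (x :: p1 ++ v :: rev q1).
  apply/andP; split.
    rewrite /= rcons_cat /= -cat_rcons cat_path pp1 last_rcons /=.
    have := rev_path e x (rcons q1 v).
    rewrite last_rcons belast_rcons rev_cons => ->.
    by rewrite (eq_path (e' := e)) // => a b; rewrite e_sym.
  move: uq; rewrite cons_uniq mem_cat negb_or => /andP[/andP[xq1 _]].
  rewrite cat_uniq => /andP[uq1 _].
  rewrite cons_uniq -cat_rcons mem_cat negb_or xp1 mem_rev.
  rewrite mem_rcons inE negb_or in xq1; case/andP: xq1 => _ ->.
  rewrite cat_uniq up1 rev_uniq; move: uq1; rewrite rcons_uniq => /andP[vq1 ->].
  rewrite /= andbT; apply/hasPn => z; rewrite mem_rev => zq1.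
  rewrite mem_rcons inE negb_or; apply/andP; split.
    by apply: contraNneq vq1 => <-.
  apply: contraNN p1q => zp1; apply/hasP; exists z => //=.
  by rewrite mem_cat mem_rcons inE zq1 orbT.
have := tree_acyclic tree cyc; rewrite /= size_cat /= size_rev.
by case: (p1) (q1) => [|? ?] [|? ?] //=; rewrite ?addnS ?addSn.
Qed.

Lemma simple_path_unique x p q :
  path e x p -> uniq (x :: p) -> path e x q -> uniq (x :: q) ->
  last x p = last x q -> p = q.
Proof.
elim: p x q => [|a p IH] x q pp up pq uq lpq.
  case: q pq uq lpq => [|b q] //= _ /andP[xq _] xl.
  by rewrite {1}xl mem_last in xq.
have := simple_paths_same_head pp up pq uq lpq.
case: q pq uq lpq => [|b q] pq uq lpq /(_ isT)/= ab.
  by move: up; rewrite cons_uniq ab inE eqxx.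
move: ab pp up pq uq lpq => <- /andP[_ pp] /andP[_ up] /andP[_ pq] /andP[_ uq].
by move=> lpq; rewrite (IH a q).
Qed.

Lemma simple_path_exists x y :
  exists p, [/\ path e x p, uniq (x :: p) & last x p = y].
Proof.
have [n [p [pp <- _]]] := tree_connected tree x y.
by case: (shortenP pp) => p' pp' up' _; exists p'.
Qed.

Lemma gdist_simple_path x p :
  path e x p -> uniq (x :: p) -> gdist e x (last x p) = size p.
Proof.
move=> pp up.
have P : connects e x (last x p) (size p) /\
    forall m, connects e x (last x p) m -> (size p <= m)%N.
  split=> [|m [q [pq lq <-]]]; first by exists p.
  move: lq; case: (shortenP pq) => q' pq' uq' sub lq'.
  rewrite (simple_path_unique pp up pq' uq' (esym lq')).
  by apply: uniq_leq_size => //; case/andP: uq'.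
apply: xget_unique => // m [m1 m2]; apply/eqP; rewrite eqn_leq.
by rewrite m2 ?P.2 //; exact: P.1.
Qed.

Lemma gdistxx x : gdist e x x = 0%N.
Proof. exact: (@gdist_simple_path x [::]). Qed.

Lemma gdist_eq1 x y : gdist e x y = 1%N -> e x y.
Proof.
have [p [pp up <-]] := simple_path_exists x y.
rewrite gdist_simple_path //; case: p pp {up} => [|a []] //=.
by rewrite andbT.
Qed.

Lemma gdist_sym x y : gdist e x y = gdist e y x.
Proof.
have [p [pp up <-]] := simple_path_exists x y.
rewrite (gdist_simple_path pp up).
have pp' : path e (last x p) (rev (belast x p)).
  by rewrite rev_path (eq_path (e' := e)) // => a b; rewrite e_sym.
have up' : uniq (last x p :: rev (belast x p)).
  by rewrite -rev_rcons rev_uniq -lastI.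
have := gdist_simple_path pp' up'; rewrite size_rev size_belast => <-.
by case: p {pp up pp' up'} => //= a p; rewrite rev_cons last_rcons.
Qed.

Lemma ray_segment (g : nat -> T) n m : (forall i, e (g i) (g i.+1)) ->
  injective g ->
  [/\ path e (g m) (map g (iota m.+1 n)), uniq (g m :: map g (iota m.+1 n)) &
      last (g m) (map g (iota m.+1 n)) = g (m + n)%N].
Proof.
move=> eg injg; split.
- by rewrite path_map; elim: n m => //= n IH m; rewrite eg IH.
- by rewrite -[_ :: _]/(map g (iota m n.+1)) map_inj_uniq ?iota_uniq.
- rewrite last_map; congr g.
  by elim: n m => [|n IH] m /=; rewrite ?addn0 // IH addSnnS.
Qed.

(** In a tree the local condition (adjacent, without repetition) already makes
a ray geodesic, so rays can be shifted and extended by hand. *)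
Lemma geodesic_rayP (g : nat -> T) : geodesic_ray e g <->
  (forall i, e (g i) (g i.+1)) /\ injective g.
Proof.
split=> [rg|[eg injg] i j ij].
  split=> [i|]; first by apply: gdist_eq1; rewrite rg // subSnn.
  suff inj i j : (i <= j)%N -> g i = g j -> i = j.
    by move=> i j gij; case/orP: (leq_total i j) => ij; [exact: inj|exact/esym/inj].
  by move=> ij gij; have := rg _ _ ij; rewrite gij gdistxx; lia.
have [pp up lp] := ray_segment (j - i) i eg injg.
by have := gdist_simple_path pp up; rewrite lp subnKC // size_map size_iota.
Qed.

(** If [y] were on the ray, beyond [g 1], then the edge from [y] back to [g 0] would
close a cycle. *)
Lemma ray_consP (g : nat -> T) y : geodesic_ray e g -> e (g 0%N) y ->
  y <> g 1%N -> geodesic_ray e (fun n => if n is m.+1 then g m else y).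
Proof.
move=> /geodesic_rayP[eg injg] gy y1.
have yg k : y <> g k.
  case: k => [|[|k]] // yk; first by move: gy; rewrite yk tree_irrefl.
  have [pp up lp] := ray_segment k.+2 0 eg injg.
  suff: ucycle e (g 0%N :: map g (iota 1 k.+2)).
    by move=> /(tree_acyclic tree); rewrite /= size_map size_iota.
  rewrite /ucycle up andbT /cycle rcons_path pp lp add0n -yk e_sym.
  by rewrite gy.
apply/geodesic_rayP; split=> [[|i]|[|i] [|j]] //=; first by rewrite e_sym.
- by move/yg.
- by move/esym/yg.
- by move/injg->.
Qed.

Lemma ray_shift (g : nat -> T) : geodesic_ray e g -> geodesic_ray e (g \o succn).
Proof. by move=> rg i j ij; rewrite /= rg ?ltnS // subSS. Qed.

(** * The parent of a vertex, and levels *)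

Variable omega : set (nat -> T).
Hypothesis end_omega : boundary e omega.

Lemma omega_ray g : omega g -> geodesic_ray e g.
Proof. by case: end_omega => g0 _ -> []. Qed.

Lemma omega_coincide g h : omega g -> omega h -> eventually_coincide g h.
Proof.
case: end_omega => g0 _ -> [_ [m [n gg]]] [_ [m' [n' hh]]].
exists (n + m')%N, (n' + m)%N => k.
by rewrite -addnA -gg addnCA hh addnA.
Qed.

Lemma omega_tail g h : omega g -> geodesic_ray e h ->
  eventually_coincide g h -> omega h.
Proof.
case: end_omega => g0 _ -> [_ [m [n gg]]] rh [m' [n' hh]]; split=> //.
exists (m + m')%N, (n' + n)%N => k.
by rewrite -addnA gg addnCA hh addnA.
Qed.

(** Moving to a neighbour [y] either follows the ray or prolongs it backwards.
This single alternative gives the existence of a ray from every vertex, and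
the fact that of two neighbours one is the parent of the other. *)
Lemma omega_ray_step g y : omega g -> e (g 0%N) y ->
  (y = g 1%N /\ omega (g \o succn)) \/
  (omega (fun n => if n is m.+1 then g m else y)).
Proof.
move=> og gy; have rg := omega_ray og.
have [y1|y1] := pselect (y = g 1%N); [left|right].
  split=> //; apply: (omega_tail og (ray_shift rg)); exists 1%N, 0%N => k.
  by rewrite /= add0n.
by apply: (omega_tail og (ray_consP rg gy y1)); exists 0%N, 1%N => k.
Qed.

Lemma omega_ray_exists x : exists2 g, omega g & g 0%N = x.
Proof.
have [g0 rg0 omE] := end_omega.
have og0 : omega g0 by rewrite omE; split=> //; exists 0%N, 0%N.
have [n [p [pp <- _]]] := tree_connected tree (g0 0%N) x.
elim/last_ind: p pp {n} => [|p y IH] => [_|]; first by exists g0.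
rewrite rcons_path last_rcons => /andP[/IH[g og <-] gy].
case: (omega_ray_step og gy) => [[-> ogS]|ogc]; last by eexists; [exact: ogc|].
by eexists; [exact: ogS|].
Qed.

(** Up to a common later vertex, both rays are the simple path to it; since the
lengths agree, so do the parameters. *)
Lemma omega_ray_unique g h : omega g -> omega h -> g 0%N = h 0%N -> g = h.
Proof.
move=> og oh gh0; have [m [n gh]] := omega_coincide og oh.
have /geodesic_rayP[eg injg] := omega_ray og.
have /geodesic_rayP[eh injh] := omega_ray oh.
apply/funext => i.
have [pg ug lg] := ray_segment (m + i.+1) 0 eg injg.
have [ph uh lh] := ray_segment (n + i.+1) 0 eh injh.
rewrite -gh0 in ph uh lh.
have E : map g (iota 1 (m + i.+1)) = map h (iota 1 (n + i.+1)).
  by apply: (simple_path_unique pg ug ph uh); rewrite lg lh !add0n.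
case: i E {pg ug lg ph uh lh} => [//|i] /(congr1 (fun s => nth (g 0%N) s i)).
by rewrite !(nth_map 0%N) ?size_iota ?nth_iota ?add1n //; lia.
Qed.

Lemma ray_to_omega x : omega (ray_to omega x) /\ ray_to omega x 0 = x.
Proof.
have [g og gx] := omega_ray_exists x.
by apply: (@xgetPex _ _ [set g | omega g /\ g 0%N = x]); exists g.
Qed.

Definition parent (x : T) : T := ray_to omega x 1.

Lemma ray_to_iter x n : ray_to omega x n = iter n parent x.
Proof.
elim: n x => [|n IH] x; first by have [] := ray_to_omega x.
rewrite iterSr -IH; have [ox x0] := ray_to_omega x.
have [op p0] := ray_to_omega (parent x).
suff -> : ray_to omega (parent x) = ray_to omega x \o succn by [].
apply: omega_ray_unique => //.
apply: (omega_tail ox (ray_shift (omega_ray ox))).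
by exists 1%N, 0%N => k; rewrite /= add0n.
Qed.

Lemma gdist_iter_parent x n : gdist e x (iter n parent x) = n.
Proof.
have [/omega_ray rx x0] := ray_to_omega x.
by rewrite -ray_to_iter -{1}x0 rx // subn0.
Qed.

Lemma tleP y x n :
  (tle omega y x /\ gdist e x y = n) <-> iter n parent y = x.
Proof.
split=> [[[k <-]]|<-]; last first.
  by rewrite gdist_sym gdist_iter_parent; split=> //; exists n; rewrite ray_to_iter.
by rewrite ray_to_iter gdist_sym gdist_iter_parent => ->.
Qed.

Lemma edge_parent x : e x (parent x).
Proof. by apply: gdist_eq1; exact: (gdist_iter_parent x 1). Qed.

Lemma neighbour_parent x y : e x y -> parent x = y \/ parent y = x.
Proof.
move=> xy; have [ox x0] := ray_to_omega x.
case: (@omega_ray_step (ray_to omega x) y ox); first by rewrite x0.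
  by case=> ->; left.
move=> oc; right; have [oy y0] := ray_to_omega y.
by rewrite /parent (omega_ray_unique oy oc).
Qed.

Section Level.
Variables (R : realType) (o : T).

Lemma meet_base x : exists m n, iter m parent x = iter n parent o.
Proof.
have [ox _] := ray_to_omega x; have [oo _] := ray_to_omega o.
have [m [n mn]] := omega_coincide ox oo.
by exists m, n; have := mn 0%N; rewrite !addn0 !ray_to_iter.
Qed.

(** Beyond the meeting vertex the sequence defining the level is constant. *)
Lemma level_meet x m n : iter m parent x = iter n parent o ->
  level R e omega o x = n%:R - m%:R.
Proof.
move=> mn; apply: lim_near_cst => //; near=> j.
have nj : (n <= j)%N by near: j; exact: nbhs_infty_ge.
rewrite ray_to_iter -(subnK nj) iterD -mn -iterD gdist_iter_parent.
by rewrite subnK // !natrD natrB //; ring.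
Unshelve. all: by end_near. Qed.

Lemma level_parent x :
  level R e omega o (parent x) = level R e omega o x + 1.
Proof.
have [m [n mn]] := meet_base x.
rewrite (level_meet mn) (@level_meet (parent x) m n.+1); last first.
  by rewrite -iterSr iterS mn.
by rewrite -natr1; ring.
Qed.

Lemma successorsE x : successors R e omega o x = [set y | parent y = x].
Proof.
apply/seteqP; split=> y /= => [[xy ly]|<-].
  case: (neighbour_parent xy) => // pxy.
  move: ly; rewrite -pxy level_parent => /addrI/eqP.
  by rewrite gt_eqF // (lt_trans _ ltr01) ?ltrN10.
by rewrite /successors /= e_sym edge_parent level_parent addrK.
Qed.

End Level.
End TreeGeometry.

(** * Layers and trapezoids below a vertex *)

(** The tree enters through its parent function and its lists of children. The
number of steps from a vertex to an ancestor is unique because steps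
towards the boundary point are geodesic. *)
Section Layers.
Variables (R : realType) (T : choiceType) (mu : T -> R).
Variables (par : T -> T) (children : T -> seq T).
Hypothesis mu_gt0 : forall y, 0 < mu y.
Hypothesis par_iter_inj : forall y h k, iter h par y = iter k par y -> h = k.
Hypothesis children_uniq : forall x, uniq (children x).
Hypothesis mem_children : forall x y, (y \in children x) = (par y == x).
Hypothesis children_mass : forall x, \sum_(y <- children x) mu y = mu x.

Fixpoint layer (n : nat) (x : T) : seq T :=
  if n is m.+1 then flatten [seq layer m y | y <- children x] else [:: x].

Definition trap (x : T) (h1 h2 : nat) : seq T :=
  flatten [seq layer h x | h <- iota h1 (h2 - h1)].

Lemma uniq_flatten_map (S : eqType) (F : S -> seq T) (k : T -> S) s :
  uniq s -> (forall i, uniq (F i)) ->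
  {in s, forall i z, z \in F i -> k z = i} ->
  uniq (flatten [seq F i | i <- s]).
Proof.
move=> + uF; elim: s => //= i s IH /andP[is_ us] kF.
rewrite cat_uniq uF IH ?andbT //; last first.
  by move=> j js z; apply: kF; rewrite inE js orbT.
apply/hasPn => z /flatten_mapP[j js zj]; apply: contraNN is_ => zi.
by rewrite -(kF i _ z zi) ?mem_head // (kF j _ z zj) // inE js orbT.
Qed.

Lemma mem_layer n x y : (y \in layer n x) = (iter n par y == x).
Proof.
elim: n x => [|n IH] x /=; first by rewrite inE.
apply/flatten_mapP/eqP => [[z]|<-].
  by rewrite mem_children IH => /eqP <- /eqP ->.
by exists (iter n par y); rewrite ?mem_children ?IH.
Qed.

Lemma layer_uniq n x : uniq (layer n x).
Proof.
elim: n x => [|n IH] x //=; apply: (@uniq_flatten_map _ _ (iter n par)) => //.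
by move=> i _ z; rewrite mem_layer => /eqP.
Qed.

Lemma layer_mass n x : \sum_(y <- layer n x) mu y = mu x.
Proof.
elim: n x => [|n IH] x /=; first by rewrite big_seq1.
rewrite big_flatten big_map /= -[RHS]children_mass.
by apply: eq_bigr => y _; rewrite IH.
Qed.

Lemma mem_trap x h1 h2 y : reflect
  (exists h, (h1 <= h < h2)%N /\ iter h par y = x) (y \in trap x h1 h2).
Proof.
apply: (iffP flatten_mapP) => [[h]|[h [hh yx]]].
  by rewrite mem_iota mem_layer => hh /eqP yx; exists h; split=> //; lia.
by exists h; rewrite ?mem_iota ?mem_layer ?yx //; lia.
Qed.

Definition depth (x z : T) : nat := xget 0%N [set h | iter h par z = x].

Lemma depthE x z h : iter h par z = x -> depth x z = h.
Proof.
move=> zx; apply: xget_unique => // k; rewrite /= -zx.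
exact: par_iter_inj.
Qed.

Lemma trap_uniq x h1 h2 : uniq (trap x h1 h2).
Proof.
apply: (@uniq_flatten_map _ _ (depth x)); rewrite ?iota_uniq //.
  by move=> h; exact: layer_uniq.
by move=> h _ z; rewrite mem_layer => /eqP; exact: depthE.
Qed.

Lemma trap_mass x h1 h2 :
  \sum_(y <- trap x h1 h2) mu y = (h2 - h1)%:R * mu x.
Proof.
rewrite big_flatten big_map /= (eq_bigr (fun=> mu x)); last first.
  by move=> h _; exact: layer_mass.
by rewrite big_const_seq count_predT size_iota iter_addr_0 mulr_natl.
Qed.

Lemma trap_split_layers x h1 h h2 : (h1 <= h <= h2)%N ->
  trap x h1 h2 = trap x h1 h ++ trap x h h2.
Proof.
move=> hh; rewrite /trap -flatten_cat -map_cat.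
have -> : (h2 - h1 = (h - h1) + (h2 - h))%N by lia.
by rewrite iotaD subnKC //; lia.
Qed.

Lemma trap_split_children x h1 h2 :
  perm_eq (trap x h1.+1 h2.+1)
          (flatten [seq trap y h1 h2 | y <- children x]).
Proof.
apply: uniq_perm; first exact: trap_uniq.
  apply: (@uniq_flatten_map _ _ (fun z => iter (depth x z).-1 par z)) => //.
    by move=> y; exact: trap_uniq.
  move=> y; rewrite mem_children => /eqP yx z /mem_trap[h [_ zy]].
  by rewrite (@depthE x z h.+1) //= zy.
move=> z; apply/mem_trap/flatten_mapP => [[h [hh zx]]|].
  case: h hh zx => [|h] // hh zx.
  exists (iter h par z); first by rewrite mem_children; apply/eqP.
  by apply/mem_trap; exists h; split=> //; lia.
move=> [y]; rewrite mem_children => /eqP yx /mem_trap[h [hh zy]].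
by exists h.+1; split; [lia|rewrite /= zy].
Qed.

Variables (D : R).
Hypothesis (D_ge1 : 1 <= D).
Hypothesis par_mass : forall y, mu (par y) <= D * mu y.

Lemma iter_par_mass n y : mu (iter n par y) <= D ^+ n * mu y.
Proof.
elim: n => [|n IH]; first by rewrite mul1r.
rewrite (le_trans (par_mass _)) // exprS -mulrA ler_wpM2l //.
by rewrite (le_trans ler01).
Qed.

Variables (w : T -> R) (K beta : R) (m : nat).
Hypothesis (beta_ge12 : 12 <= beta) (beta_le : beta <= m%:R).
Hypothesis trap_spreads : forall x h1 h2, admissible beta h1 h2 ->
  spreads mu w K (trap x h1 h2).

Lemma admissibleP h1 h2 : admissible beta h1 h2 <->
  [/\ (0 < h1)%N, (2 * h1 <= h2)%N & h2%:R <= beta * h1%:R].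
Proof.
split=> [[h10 _ r2 rb]|[h10 r2 rb]].
  have p0 : 0 < h1%:R :> R by rewrite ltr0n.
  split=> //; last by rewrite -ler_pdivrMr.
  by move: r2; rewrite ler_pdivlMr // -natrM ler_nat.
have p0 : 0 < h1%:R :> R by rewrite ltr0n.
split=> //; first by lia.
  by rewrite ler_pdivlMr // -natrM ler_nat.
by rewrite ler_pdivrMr.
Qed.

(** Each cut decreases [2 * h2 - h1], which is the induction measure. The vertical
cut replaces the heights by [h1 - 1] and [h2 - 1]; it is used only when
[h2 < 4 * h1] and [2 <= h1], where the new ratio stays below 12, hence
below [beta]. The factor [beta * D ^ m] is dictated by the case [h1 = 1],
where points lie at depth less than [beta <= m] below the root. *)
Lemma dyadic_trap x h1 h2 : admissible beta h1 h2 ->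
  dyadic mu w (beta * D ^+ m) K (trap x h1 h2).
Proof.
have b12 := beta_ge12; have bm := beta_le; have D1 := D_ge1.
have Dm : 1 <= D ^+ m by exact: exprn_ege1.
have Nb : beta <= beta * D ^+ m.
  by rewrite ler_peMr // (le_trans _ beta_ge12).
have [n] := ubnP (2 * h2 - h1)%N; elim: n x h1 h2 => // n IH x h1 h2 rk adm.
have [h10 r2 rb] := (admissibleP h1 h2).1 adm.
have mx := mu_gt0 x.
(* Lower height 1: the pieces are the points. *)
have [h11|h11] := eqVneq h1 1%N.
  apply: (@dyadic_split _ _ _ _ _ _ _ [seq [:: y] | y <- trap x h1 h2]).
  - exact: trap_spreads.
  - by rewrite flatten_seq1.
  - move=> _ /mapP[y /mem_trap[h [hh <-]] ->].
    rewrite big_seq1 trap_mass.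
    have /le_trans -> // : (h2 - h1)%:R * mu (iter h par y) <=
        beta * (D ^+ h * mu y).
      apply: ler_pM; rewrite ?(ltW (mu_gt0 _)) ?iter_par_mass //.
      by rewrite h11 mulr1 in rb; rewrite (le_trans _ rb) // ler_nat; lia.
    rewrite -mulrA ler_wpM2l ?ler_wpM2r ?(ltW (mu_gt0 _)) //; first lra.
    rewrite ler_weXn2l //.
    have : h2%:R <= m%:R :> R.
      by rewrite (le_trans _ beta_le) // (le_trans rb) // h11 mulr1.
    by rewrite ler_nat; lia.
  - by move=> _ /mapP[y _ ->]; exact: dyadic_point.
have {h11} h12 : (1 < h1)%N by lia.
(* Tall: cut horizontally at height [2 * h1]. *)
have [h4|h4] := leqP (4 * h1) h2.
  have adm1 : admissible beta h1 (2 * h1).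
    apply/admissibleP; split=> //; rewrite natrM ler_wpM2r //; lra.
  have adm2 : admissible beta (2 * h1) h2.
    apply/admissibleP; split; [lia|lia|].
    rewrite (le_trans rb) // ler_wpM2l ?ler_nat ?leq_pmull //; lra.
  apply: (@dyadic_split _ _ _ _ _ _ _
            [:: trap x h1 (2 * h1); trap x (2 * h1) h2]).
  - exact: trap_spreads.
  - by rewrite (@trap_split_layers _ _ (2 * h1)) /= ?cats0 //; lia.
  - move=> q; rewrite !inE => /orP[] /eqP->; rewrite !trap_mass mulrA.
      rewrite ler_wpM2r ?(ltW mx) //.
      apply: (@le_trans _ _ (beta * h1%:R)).
        by rewrite (le_trans _ rb) // ler_nat; lia.
      by rewrite (_ : (2 * h1 - h1 = h1)%N) ?ler_wpM2r //; lia.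
    rewrite ler_wpM2r ?(ltW mx) //.
    apply: (@le_trans _ _ (2 * (h2 - 2 * h1)%:R)).
      by rewrite -natrM ler_nat; lia.
    by rewrite ler_wpM2r //; lra.
  - move=> q; rewrite !inE => /orP[] /eqP->; apply: IH => //; lia.
(* Short: cut vertically along the children of the root. *)
case: h1 h2 rk adm h10 r2 rb h12 h4 => [//|h1] [|h2] rk adm _ r2 rb h12 h4.
  by lia.
have adm' : admissible beta h1 h2.
  apply/admissibleP; split; [lia|lia|].
  apply: (@le_trans _ _ (12 * h1%:R)); last by rewrite ler_wpM2r.
  by rewrite -natrM ler_nat; lia.
apply: (@dyadic_split _ _ _ _ _ _ _ [seq trap y h1 h2 | y <- children x]).
- exact: trap_spreads.
- exact: trap_split_children.
- move=> _ /mapP[y yx ->]; rewrite !trap_mass subSS mulrCA ler_wpM2l //.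
  move: yx; rewrite mem_children => /eqP <-.
  rewrite (le_trans (par_mass y)) // ler_wpM2r ?(ltW (mu_gt0 _)) //.
  have m0 : (0 < m)%N by rewrite -(ltr0n R); lra.
  have : D <= D ^+ m by rewrite -[leLHS]expr1 ler_weXn2l.
  nra.
- by move=> _ /mapP[y _ ->]; apply: IH => //; lia.
Qed.

End Layers.

(** * Flow measures on the tree *)

Section FlowOnTree.
Variables (R : realType) (T : choiceType) (e : rel T).
Variables (omega : set (nat -> T)) (o : T) (mu : T -> R).
Hypotheses (tree : infinite_tree e) (end_omega : boundary e omega).
Hypotheses (flow : flow_measure e omega o mu).
Hypotheses (doubling : locally_doubling e mu).

Local Notation par := (parent omega).

(** Doubling at radius 1/2: the ball of radius 1/2 is a point, and the ball of
radius 1 contains the parent. *)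
Lemma parent_mass : exists2 D : R, 1 <= D & forall x, mu (par x) <= D * mu x.
Proof.
have [mu_gt0 _] := flow.
have mu0 y : (0 <= (mu y)%:E)%E by rewrite lee_fin ltW.
have [|D HD] := doubling (r := 2^-1); first by rewrite invr_gt0.
exists (Num.max 1 D); first by rewrite le_max lexx.
move=> x; have := HD x; rewrite divff //.
have -> : gball e x (2^-1 : R) = [set x].
  apply/seteqP; split=> y /= => [xy|->]; last first.
    by rewrite /gball /= gdistxx // invr_ge0.
  have : (gdist e x y < 1)%N.
    by rewrite -(ltr_nat R) (le_lt_trans xy) // invf_lt1 // ltr1n.
  have [q [pq uq <-]] := simple_path_exists tree x y.
  by rewrite gdist_simple_path //; case: q {pq uq}.
rewrite {2}/mass esum_set1 // => Hx.
have : ((mu (par x))%:E <= mass mu (gball e x (1 : R)))%E.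
  rewrite /mass; apply: esum_ge; exists [set par x]; last by rewrite fsbig_set1.
  split; first exact: finite_set1.
  move=> _ ->; rewrite /gball /=.
  by rewrite -[par x]/(iter 1 par x) (gdist_iter_parent tree end_omega).
move=> /le_trans/(_ Hx); rewrite -EFinM lee_fin => /le_trans -> //.
by rewrite ler_wpM2r ?le_max ?lexx ?orbT // ltW.
Qed.

(** Each child has mass at least [mu x / D], and the masses add up to [mu x], so
there are at most [D] children. *)
Lemma finite_children x : finite_set [set y | par y = x].
Proof.
have [mu_gt0 mass_s] := flow; have [D D1 HD] := parent_mass.
have D0 : 0 < D by rewrite (lt_le_trans ltr01).
apply: contrapT => /(@infinite_set_fset _ _ (Num.truncn D).+1)[B BE nB].
have uB : uniq (finmap.enum_fset B) by exact: finmap.fset_uniq.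
have : ((\sum_(y <- finmap.enum_fset B) mu y)%:E <= (mu x)%:E)%E.
  rewrite mass_s (successorsE tree end_omega).
  rewrite /mass; apply: esum_ge; exists [set` finmap.enum_fset B].
    by split; [exact: finite_seq|exact: BE].
  by rewrite fsumEFin ?(fsbig_seq _ _ uB) //; exact: finite_seq.
rewrite lee_fin leNgt => /negP; apply.
apply: (@lt_le_trans _ _ (\sum_(y <- finmap.enum_fset B) mu x / D)).
  rewrite big_const_seq count_predT iter_addr_0 -mulr_natl mulrCA ltr_pMr //.
  by rewrite ltr_pdivlMr // mul1r (lt_le_trans (truncnS_gt D)) // ler_nat.
rewrite big_seq [leRHS]big_seq; apply: ler_sum => y yB.
rewrite ler_pdivrMr // mulrC.
by have /= <- := BE _ yB.
Qed.

Lemma children_exist x : exists s : seq T,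
  [/\ uniq s, forall y, (y \in s) = (par y == x) & \sum_(y <- s) mu y = mu x].
Proof.
have [mu_gt0 mass_s] := flow.
have [s sE] := (finite_seqP _).1 (finite_children x).
have us := undup_uniq s.
have mem y : (y \in undup s) = (par y == x).
  rewrite mem_undup; apply/idP/eqP => [ys|yx].
    have : [set` s] y by [].
    by rewrite -sE.
  by have : [set y | par y = x] y by []; rewrite sE.
exists (undup s); split=> //; apply: EFin_inj.
have mu0 y : 0 <= mu y by exact: ltW.
rewrite mass_s (successorsE tree end_omega) -(esum_uniq_seq us mu0).
rewrite /mass; congr esum; apply/seteqP; split=> y /=; rewrite mem.
  by move/eqP.
by move/eqP.
Qed.

Lemma trapezoid_trap (children : T -> seq T) x h1 h2 :
  (forall z y, (y \in children z) = (par y == z)) ->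
  trapezoid e omega x h1 h2 = [set` trap children x h1 h2].
Proof.
move=> memC; apply/seteqP; split=> y /=.
  move=> [yx hh]; apply/(mem_trap memC); exists (gdist e x y); split=> //.
  exact: (tleP tree end_omega y x (gdist e x y)).1 (conj yx erefl).
move=> /(mem_trap memC)[h [hh /(tleP tree end_omega y x h).2[yx yh]]].
by rewrite /trapezoid /= yh.
Qed.

End FlowOnTree.

(** * The reverse Holder inequality *)

Theorem theorem3p3 (R : realType) (T : choiceType) (e : rel T)
    (omega : set (nat -> T)) (o : T) (mu : T -> R) (beta : R)
    (p : R) (w : T -> R) :
  infinite_tree e ->
  boundary e omega ->
  flow_measure e omega o mu ->
  locally_doubling e mu ->
  12 <= beta ->
  1 <= p ->
  weight w ->
  Ap e omega mu beta p w ->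
  exists C eps : R, [/\ 0 < C, 0 < eps &
    forall E : set T, trapezoids e omega beta E ->
      avg mu (fun y => w y `^ (1 + eps)) E `^ (1 + eps)^-1
      <= C * avg mu w E].
Proof.
move=> tree end_omega flow doubling beta12 p1 w_gt0 ApH.
have [mu_gt0 _] := flow.
have [D D1 par_mass] := parent_mass tree end_omega flow doubling.
have [children childrenP] :=
  choice (children_exist tree end_omega flow doubling).
have cuniq x : uniq (children x) by have [] := childrenP x.
have cmem x y : (y \in children x) = (parent omega y == x).
  by have [_ ->] := childrenP x.
have csum x : \sum_(y <- children x) mu y = mu x by have [] := childrenP x.
have pinj y h k : iter h (parent omega) y = iter k (parent omega) y -> h = k.
  by move=> hk; rewrite -(gdist_iter_parent tree end_omega y h) hk
    (gdist_iter_parent tree end_omega).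
have trapE := trapezoid_trap tree end_omega _ _ _ cmem.
have [K K1 trap_spreads] := Ap_spreads_uniform mu_gt0 w_gt0 p1 ApH.
have trap_neq0 x h1 h2 : admissible beta h1 h2 -> trap children x h1 h2 != [::].
  move=> [_ h12 _ _]; apply/eqP => t0.
  have := trap_mass csum x h1 h2; rewrite t0 big_nil => /esym/eqP.
  by rewrite mulf_eq0 pnatr_eq0 [mu x == 0]gt_eqF // orbF; lia.
pose m := (Num.truncn beta).+1.
have bm : beta <= m%:R by exact/ltW/truncnS_gt.
have dtrap x h1 h2 : admissible beta h1 h2 ->
    dyadic mu w (beta * D ^+ m) K (trap children x h1 h2).
  apply: (dyadic_trap mu_gt0 pinj cuniq cmem csum D1 par_mass beta12 bm).
  move=> {}x {}h1 {}h2 adm; apply: trap_spreads.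
  - exact: (trap_uniq pinj cuniq cmem).
  - exact: trap_neq0.
  - by left; exists x, h1, h2; rewrite trapE.
have N1 : 1 <= beta * D ^+ m.
  by have := exprn_ege1 m D1; nra.
have [C [eps [C0 eps0 HRH]]] := dyadic_reverse_Holder mu_gt0 w_gt0 N1 K1.
exists (C `^ (1 + eps)^-1), eps; split=> //; first exact: powR_gt0.
move=> E tE.
have [Q [uQ Q0 dQ ->]] : exists Q, [/\ uniq Q, Q != [::],
    dyadic mu w (beta * D ^+ m) K Q & E = [set` Q]].
  case: tE => [[x [h1 [h2 [adm ->]]]]|[x ->]].
    exists (trap children x h1 h2); rewrite trapE; split=> //.
    - exact: (trap_uniq pinj cuniq cmem).
    - exact: trap_neq0.
    - exact: dtrap.
  exists [:: x]; split=> //; first exact: dyadic_point.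
  by apply/seteqP; split=> y /=; rewrite inE => /eqP.
have MQ := mass_gt0 mu_gt0 Q0.
have w0 y : 0 <= w y by exact: ltW.
rewrite !avg_uniq_seq //=; last by move=> y; exact: powR_ge0.
set M := \sum_(y <- Q) mu y in MQ *.
have WQ : 0 < \sum_(y <- Q) w y * mu y.
  by apply: (@mass_gt0 _ _ (fun y => w y * mu y)) => // y; rewrite mulr_gt0.
have t0 := divr_gt0 WQ MQ.
have := HRH Q _ dQ t0; rewrite divfK ?gt_eqF // => /(_ (lexx _)).
set W := \sum_(y <- Q) w y * mu y in WQ t0 *.
rewrite -(ler_pM2r (_ : 0 < M^-1)) ?invr_gt0 // -!mulrA.
have -> : (W / M) `^ eps * (W / M) = (W / M) `^ (1 + eps).
  rewrite powRD; last by rewrite [W / M == 0]gt_eqF ?implybT.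
  by rewrite powRr1 ?(ltW t0) // mulrC.
have e1 : 0 < 1 + eps by rewrite addr_gt0.
have e1i : 0 <= (1 + eps)^-1 by rewrite invr_ge0 ltW.
move=> H; apply: le_trans (ge0_ler_powR e1i _ _ H) _.
- rewrite nnegrE divr_ge0 ?(ltW MQ) // sumr_ge0 // => y _.
  by rewrite mulr_ge0 ?powR_ge0 // ltW.
- by rewrite nnegrE mulr_ge0 ?powR_ge0 // ltW.
rewrite (powRM _ (ltW C0) (powR_ge0 _ _)) -powRrM mulfV ?gt_eqF //.
by rewrite powRr1 // ltW.
Qed.
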